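(* Let $(X,Y)$ be a bivariate normal random vector in $\mathbb R^2$ with $\mathrm{Var}(X)>0$, $\mathrm{Var}(Y)>0$ and Pearson correlation $\varrho$. Using the metric $\delta(x,y)=|x-y|$ on $\mathbb R$ and the Manhattan metric on pairs, \[ \mathrm{eCor}(X,Y)\le\Big[1-\sqrt{1-\varrho^2}\,\Big]^{1/2}\le|\varrho|, \] and the last inequality is strict unless $\varrho\in\{-1,0,1\}$.
   Context: For probability measures $\mu,\nu$ on a metric space $(S,\rho)$ with finite first moments, $e(\mu,\nu)=\inf_\gamma\int\rho\,d\gamma$ over all couplings $\gamma$ of $\mu,\nu$ (earth mover's / Wasserstein-1 distance). For real random variables $X,Y$, pairs are given the Manhattan metric $d[(x,y),(u,v)]=|x-u|+|y-v|$. The earth mover's covariance is $\mathrm{eCov}(X,Y)=e\big[(X,Y),(X',Y')\big]$, the distance (w.r.t. $d$) between the joint law of $(X,Y)$ and the product of its marginals (law of $(X',Y')$ with $X'\overset d=X$, $Y'\overset d=Y$, $X',Y'$ independent). The earth mover's variance is $\mathrm{eVar}(X)=\mathrm{eCov}(X,X)$, and the earth mover's correlation is $\mathrm{eCor}(X,Y)=\mathrm{eCov}(X,Y)/\min\{\mathrm{eVar}(X),\mathrm{eVar}(Y)\}$, defined when the denominator is positive. *)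

(* Defs.v *)
From HB Require Import structures.
From mathcomp Require Import all_boot all_order all_algebra.
From mathcomp Require Import all_classical all_reals all_analysis.
Set Implicit Arguments. Unset Strict Implicit. Unset Printing Implicit Defensive.
Import Order.TTheory GRing.Theory Num.Theory.
Local Open Scope classical_set_scope.
Local Open Scope ring_scope.

Section EarthMover.
Context {R : realType}.
Local Open Scope ereal_scope.

Definition manhattan (z : (R * R) * (R * R)) : R :=
  (`| z.1.1 - z.2.1 | + `| z.1.2 - z.2.2 |)%R.

Definition is_coupling (mu nu : set (R * R) -> \bar R)
  (gamma : probability ((R * R) * (R * R))%type R) : Prop :=
  forall A : set (R * R), measurable A ->
    gamma (fst @^-1` A) = mu A /\ gamma (snd @^-1` A) = nu A.

Definition emd (mu nu : set (R * R) -> \bar R) : \bar R :=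
  ereal_inf [set \int[gamma]_z (manhattan z)%:E
            | gamma in [set gamma | is_coupling mu nu gamma]].

Definition joint_law d (T : measurableType d) (P : probability T R)
  (X Y : T -> R) : set (R * R) -> \bar R :=
  fun A => P ((fun t => (X t, Y t)) @^-1` A).

Definition eCov d (T : measurableType d) (P : probability T R)
  (X Y : {RV P >-> R}) : \bar R :=
  emd (joint_law P X Y) (distribution P X \x distribution P Y).

Definition eVar d (T : measurableType d) (P : probability T R)
  (X : {RV P >-> R}) : \bar R := eCov X X.

Definition eCor d (T : measurableType d) (P : probability T R)
  (X Y : {RV P >-> R}) : R :=
  (fine (eCov X Y) / fine (Order.min (eVar X) (eVar Y)))%R.

(* (X, Y) is a bivariate normal vector: its joint law is the image of the
   standard normal law on R^2 under an affine map. *)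
Definition bivariate_normal d (T : measurableType d) (P : probability T R)
  (X Y : T -> R) : Prop :=
  exists m1 m2 a b c e : R,
    forall A : set (R * R), measurable A ->
      joint_law P X Y A =
      (normal_prob (0:R) 1 \x normal_prob (0:R) 1)
        ((fun z : R * R => (m1 + a * z.1 + b * z.2, m2 + c * z.1 + e * z.2)%R)
           @^-1` A).

Definition pearson d (T : measurableType d) (P : probability T R)
  (X Y : T -> R) : R :=
  (fine (covariance P X Y) /
   Num.sqrt (fine (variance P X) * fine (variance P Y)))%R.

End EarthMover.

(* Main.v *)
(* For a standard Gaussian vector (U, V), rotation invariance gives
   E|aU + bV| = sqrt(a^2 + b^2) E|U|, so all the first moments involved are
   multiples of the single constant E|U|, which cancels in the quotient.
   Let s1, s2 be the standard deviations of X, Y.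
   Numerator: write Y = E Y + s2 (rho U + sqrt(1 - rho^2) V), where U is the
   standardization of X. Keeping X and replacing Y by E Y + s2 V is a coupling of the
   joint law with the product of its marginals, and its cost is
   E|s2 (rho U + (sqrt(1 - rho^2) - 1) V)|
     = s2 sqrt(2 (1 - sqrt(1 - rho^2))) E|U|; symmetrically with X and Y exchanged.
   Denominator: the distance from a diagonal point (x, x) to (u, v) is at least
   |u - v|, so eVar X >= E|X' - X''| = sqrt 2 s1 E|U| with X', X'' independent. *)
Require Import Defs.
From HB Require Import structures.
From mathcomp Require Import all_boot all_order all_algebra.
From mathcomp Require Import all_classical all_reals all_analysis.
From mathcomp Require Import measurable_realfun.
From mathcomp Require Import ring lra.
Set Implicit Arguments.
Unset Strict Implicit.
Unset Printing Implicit Defensive.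
Import Order.TTheory GRing.Theory Num.Theory.
Local Open Scope classical_set_scope.
Local Open Scope ring_scope.

(** * Integration against an image measure *)

Lemma ge0_integral_law {d1 d2} {T1 : measurableType d1} {T2 : measurableType d2}
    {R : realType} (mu : measure T1 R) (nu : measure T2 R) (phi : T1 -> T2)
    (g : T2 -> \bar R) :
  measurable_fun setT phi ->
  (forall A, measurable A -> nu A = mu (phi @^-1` A)) ->
  measurable_fun setT g -> (forall y, 0 <= g y)%E ->
  (\int[nu]_y g y = \int[mu]_x g (phi x))%E.
Proof.
move=> mphi law mg g0.
pose phim := isMeasurableFun.Build _ _ _ _ _ mphi.
pose phi' : {mfun T1 >-> T2} := HB.pack phi phim.
transitivity (\int[pushforward mu phi']_y g y)%E; last first.
  by rewrite ge0_integral_pushforward.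
by apply: eq_measure_integral => A mA _; rewrite law.
Qed.

(** Positive and negative parts commute with composition by [phi], which reduces to the nonnegative
    case. *)
Lemma integral_law {d1 d2} {T1 : measurableType d1} {T2 : measurableType d2}
    {R : realType} (mu : measure T1 R) (nu : measure T2 R) (phi : T1 -> T2)
    (g : T2 -> \bar R) :
  measurable_fun setT phi ->
  (forall A, measurable A -> nu A = mu (phi @^-1` A)) ->
  measurable_fun setT g ->
  (\int[nu]_y g y = \int[mu]_x g (phi x))%E.
Proof.
move=> mphi law mg; rewrite integralE [RHS]integralE -![fun x => g (phi x)]/(g \o phi).
rewrite [in RHS]funepos_comp [in RHS]funeneg_comp; congr (_ - _)%E.
- by rewrite (ge0_integral_law mphi law)//; exact: measurable_funepos.
- by rewrite (ge0_integral_law mphi law)//; exact: measurable_funeneg.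
Qed.

(** * Linear changes of variables for Lebesgue measure on the plane *)
Section lebesgue.
Context {R : realType}.
Notation mu := (@lebesgue_measure R).
Implicit Types (a b c e : R).

Lemma measurable_affine a b : measurable_fun setT (fun x : R => a * x + b).
Proof. by apply: measurable_funD => //; exact: measurable_funM. Qed.

(** Lebesgue measure is determined by its values on the intervals []x, y]]. For [a < 0] their
    preimages are closed on the left and open on the right, which does not change the length. *)
Lemma lebesgue_measure_affine a b (A : set R) : a != 0 -> measurable A ->
  (mu A = `|a|%:E * mu ((fun x => a * x + b)%R @^-1` A))%E.
Proof.
move=> a0 mA.
pose phim := @isMeasurableFun.Build _ _ (measurableTypeR R) (measurableTypeR R) _
  (measurable_affine a b).
pose phi : {mfun measurableTypeR R >-> measurableTypeR R} :=
  HB.pack (fun x : R => a * x + b) phim.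
rewrite (@lebesgue_measure_unique R (mscale (NngNum (normr_ge0 a)) (pushforward mu phi)))//.
move=> _ [[x y]] _ <-.
change (mu `]x, y]%classic =
  `|a|%:E * mu ((fun z : R => a * z + b)%R @^-1` `]x, y]%classic))%E.
have [a_gt0|a_lt0|] := ltgtP 0 a; last by move/esym/eqP; rewrite (negbTE a0).
- rewrite [X in (_ * mu X)%E](_ : _ = `](x - b) / a, (y - b) / a]%classic); last first.
    apply/seteqP; split => z /=; rewrite !in_itv /= ltr_pdivrMr// ler_pdivlMr//;
    by rewrite ltrBlDr lerBrDr (mulrC z).
  rewrite !lebesgue_measure_itv/= !lte_fin ltr_pM2r ?invr_gt0// ltrD2r.
  case: ifPn => _; rewrite ?mule0// -!EFinD -EFinM gtr0_norm//.
  by congr EFin; field; rewrite gt_eqF.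
- rewrite [X in (_ * mu X)%E](_ : _ = `[(y - b) / a, (x - b) / a[%classic); last first.
    apply/seteqP; split => z /=; rewrite !in_itv /= ltr_ndivlMr// ler_ndivrMr//;
    by rewrite ltrBlDr lerBrDr (mulrC z) andbC.
  rewrite !lebesgue_measure_itv/= !lte_fin ltr_nM2r ?invr_lt0// ltrD2r.
  case: ifPn => _; rewrite ?mule0// -!EFinD -EFinM ltr0_norm//.
  by congr EFin; field; rewrite lt_eqF.
Qed.

Lemma ge0_integral_affine a b (f : R -> \bar R) : a != 0 ->
  measurable_fun setT f -> (forall x, 0 <= f x)%E ->
  (\int[mu]_x f x = `|a|%:E * \int[mu]_x f (a * x + b)%R)%E.
Proof.
move=> a0 mf f0.
rewrite -(ge0_integral_mscale _ _ (NngNum (normr_ge0 a)))//; last first.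
  by apply: measurableT_comp => //; exact: measurable_affine.
apply: (@ge0_integral_law _ _ (measurableTypeR R) (measurableTypeR R) R
  (mscale (NngNum (normr_ge0 a)) mu) mu (fun x => a * x + b) f) => //.
  exact: measurable_affine.
by move=> A mA; exact: lebesgue_measure_affine.
Qed.

Notation mu2 := (mu \x mu)%E.

Definition lin2 a b c e (z : R * R) : R * R :=
  (a * z.1 + b * z.2, c * z.1 + e * z.2).

Lemma measurable_lin2 a b c e : measurable_fun setT (lin2 a b c e).
Proof.
apply/measurable_fun_pairP; split; apply: measurable_funD; apply: measurable_funM => //.
Qed.

Lemma measurable_comp_lin2 a b c e (f : R * R -> \bar R) :
  measurable_fun setT f -> measurable_fun setT (fun z => f (lin2 a b c e z)).
Proof. by move=> mf; apply: measurableT_comp => //; exact: measurable_lin2. Qed.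

(** By Tonelli: for fixed [x] this is the one-dimensional change of variable
    [y |-> e * y + c * x]. *)
Lemma ge0_integral_lin2_lower c e (f : R * R -> \bar R) :
  e != 0 -> measurable_fun setT f -> (forall z, 0 <= f z)%E ->
  (\int[mu2]_z f z = `|e|%:E * \int[mu2]_z f (lin2 1 0 c e z))%E.
Proof.
move=> e0 mf f0.
have mfl := measurable_comp_lin2 1 0 c e mf.
rewrite [in RHS]fubini_tonelli1// [in LHS]fubini_tonelli1// -ge0_integralZl//; last 2 first.
- exact: measurable_fun_fubini_tonelli_F.
- by move=> x _; exact: integral_ge0.
apply: eq_integral => x _; rewrite /fubini_F (ge0_integral_affine (c * x) e0)//.
  congr (_ * _)%E; apply: eq_integral => y _.
  by rewrite /lin2/= mul1r mul0r addr0 addrC.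
exact: measurableT_comp.
Qed.

Lemma ge0_integral_lin2_upper a b (f : R * R -> \bar R) :
  a != 0 -> measurable_fun setT f -> (forall z, 0 <= f z)%E ->
  (\int[mu2]_z f z = `|a|%:E * \int[mu2]_z f (lin2 a b 0 1 z))%E.
Proof.
move=> a0 mf f0.
have mfl := measurable_comp_lin2 a b 0 1 mf.
rewrite [in RHS]fubini_tonelli2// [in LHS]fubini_tonelli2// -ge0_integralZl//; last 2 first.
- exact: measurable_fun_fubini_tonelli_G.
- by move=> x _; exact: integral_ge0.
apply: eq_integral => y _; rewrite /fubini_G (ge0_integral_affine (b * y) a0)//.
  congr (_ * _)%E; apply: eq_integral => x _.
  by rewrite /lin2/= mul1r mul0r add0r.
exact: measurableT_comp.
Qed.

(** For [a != 0] the matrix factors as the lower map [lin2 1 0 (c / a) ((a * e - b * c) / a)] after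
    the upper map [lin2 a b 0 1], and the determinants multiply. *)
Lemma ge0_integral_lin2 a b c e (f : R * R -> \bar R) :
  a * e - b * c != 0 -> measurable_fun setT f -> (forall z, 0 <= f z)%E ->
  (\int[mu2]_z f z = `|a * e - b * c|%:E * \int[mu2]_z f (lin2 a b c e z))%E.
Proof.
wlog a0 : a c / a != 0 => [ih|] D0 mf f0.
  have [aE|] := eqVneq a 0; last by move=> ?; exact: ih.
  (* A shear turns the first column (0, c) into (b, c + e). *)
  have b0 : a + b != 0.
    by apply: contra_neq D0; rewrite aE add0r => ->; rewrite !mul0r subrr.
  have DE : (a + b) * e - b * (c + e) = a * e - b * c by ring.
  rewrite (ih (a + b) (c + e))// DE//; congr (_ * _)%E.
  rewrite [RHS](@ge0_integral_lin2_lower 1 1) ?oner_eq0//; last exact: measurable_comp_lin2.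
  rewrite normr1 mul1e; apply: eq_integral => z _; congr f.
  by rewrite /lin2/=; congr pair; ring.
rewrite (@ge0_integral_lin2_lower (c / a) ((a * e - b * c) / a))//; last first.
  by rewrite mulf_neq0// invr_neq0.
rewrite (ge0_integral_lin2_upper b a0)//; last exact: measurable_comp_lin2.
rewrite muleA -EFinM -normrM divfK//; congr (_ * _)%E.
apply: eq_integral => z _; congr f; rewrite /lin2/=; congr pair; first by ring.
by field.
Qed.
End lebesgue.

(** * Rotation invariance and moments of the standard Gaussian on the plane *)
Section gauss2.
Context {R : realType}.
Notation mu := (@lebesgue_measure R).
Notation mu2 := (mu \x mu)%E.
Implicit Types (a b c e : R).
Local Notation N01 := (@normal_prob R 0 1).
Local Notation phi := (@normal_pdf R 0 1).

(* The carrier is retyped from [measurableTypeR R * measurableTypeR R] to [R * R],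
   the type over which the laws of the statement are defined. *)
Definition gauss2 : set (R * R) -> \bar R := (N01 \x N01)%E.

Let gauss2_0 : gauss2 set0 = 0%E. Proof. exact: measure0. Qed.
Let gauss2_ge0 A : (0 <= gauss2 A)%E. Proof. exact: measure_ge0. Qed.
Let gauss2_sigma_additive : semi_sigma_additive gauss2.
Proof.
exact: (@measure_semi_sigma_additive _ (measurableTypeR R * measurableTypeR R)%type R
  (N01 \x N01)%E).
Qed.
HB.instance Definition _ := isMeasure.Build _ _ _ gauss2 gauss2_0 gauss2_ge0 gauss2_sigma_additive.
Let gauss2_T : gauss2 setT = 1%E.
Proof.
exact: (@probability_setT _ (measurableTypeR R * measurableTypeR R)%type R (N01 \x N01)%E).
Qed.
HB.instance Definition _ := @Measure_isProbability.Build _ _ R gauss2 gauss2_T.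

Definition gauss2_density (z : R * R) : R := phi z.1 * phi z.2.

Lemma gauss2_density_ge0 z : 0 <= gauss2_density z.
Proof. by rewrite mulr_ge0// normal_pdf_ge0. Qed.

Lemma measurable_gauss2_density : measurable_fun setT gauss2_density.
Proof.
by apply: measurable_funM; apply: measurableT_comp => //; exact: measurable_normal_pdf.
Qed.

Let dens A : \bar R := (\int[mu2]_(z in A) (gauss2_density z)%:E)%E.
Let dens0 : dens set0 = 0%E. Proof. exact: integral_set0. Qed.
Let dens_ge0 A : (0 <= dens A)%E.
Proof. by apply: integral_ge0 => z _; rewrite lee_fin gauss2_density_ge0. Qed.
Let dens_sigma_additive : semi_sigma_additive dens.
Proof.
move=> A mA tA mUA; rewrite /dens ge0_integral_bigcup//.
- by apply: is_cvg_ereal_nneg_natsum_cond => n _ _; exact: dens_ge0.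
- by apply/measurable_EFinP; apply: measurable_funTS; exact: measurable_gauss2_density.
- by move=> z _; rewrite lee_fin gauss2_density_ge0.
Qed.
HB.instance Definition _ := isMeasure.Build _ _ _ dens dens0 dens_ge0 dens_sigma_additive.

(** A product measure is determined by its values on rectangles, so it is enough to compute [dens]
    there, where Tonelli splits the integral. *)
Lemma gauss2E A : measurable A ->
  gauss2 A = (\int[mu2]_(z in A) (gauss2_density z)%:E)%E.
Proof.
move=> mA; rewrite -/(dens A).
apply: (@product_measure_unique _ _ _ _ _ N01 N01 dens) => // {A mA} A B mA mB.
rewrite /= /dens integral_mkcond.
(* Extending the density by 0 outside the set makes the integrand on a rectangle a product of
   one-variable functions. *)
pose f (A : set R) (x : R) : \bar R := ((fun x => (phi x)%:E) \_ A) x.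
have f0 C x : (0 <= f C x)%E.
  by rewrite /f patchE; case: ifPn => // _; rewrite lee_fin normal_pdf_ge0.
have mf C : measurable C -> measurable_fun setT (f C).
  move=> mC; apply/(measurable_restrictT _ _).1 => //.
  by apply: measurable_funTS; apply/measurable_EFinP; exact: measurable_normal_pdf.
transitivity (\int[mu2]_z (f A z.1 * f B z.2))%E.
  apply: eq_integral => -[x y] _; rewrite /f !patchE in_setX/=.
  by case: (x \in A); case: (y \in B); rewrite /= ?mule0 ?mul0e// EFinM.
rewrite fubini_tonelli1//=; last 2 first.
- by apply: emeasurable_funM; apply: measurableT_comp => //; exact: mf.
- by move=> z; rewrite mule_ge0.
rewrite /fubini_F /=.
transitivity (\int[mu]_x (f A x * \int[mu]_y f B y))%E.
  by apply: eq_integral => x _; rewrite ge0_integralZl//; exact: mf.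
rewrite ge0_integralZr//; last 2 first.
- exact: mf.
- exact: integral_ge0.
by congr (_ * _)%E; rewrite /normal_prob [RHS]integral_mkcond.
Qed.

Lemma gauss2_densityE z : gauss2_density z =
  normal_peak 1 ^+ 2 * expR (- (z.1 ^+ 2 + z.2 ^+ 2) / 2).
Proof.
rewrite /gauss2_density /normal_pdf oner_eq0 /normal_fun mulrACA -expr2 -expRD.
by congr (_ * expR _); rewrite !subr0 expr1n -mulrDl -opprD.
Qed.

(** The hypotheses say that the columns of the matrix are orthonormal, so the map preserves
    [z.1 ^+ 2 + z.2 ^+ 2], through which alone the density depends on [z]. *)
Lemma gauss2_density_rot a b c e z : a ^+ 2 + c ^+ 2 = 1 -> b ^+ 2 + e ^+ 2 = 1 ->
  a * b + c * e = 0 -> gauss2_density (lin2 a b c e z) = gauss2_density z.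
Proof.
move=> ac1 be1 abce.
rewrite [LHS]gauss2_densityE [RHS]gauss2_densityE.
have -> : (lin2 a b c e z).1 ^+ 2 + (lin2 a b c e z).2 ^+ 2 =
    (a ^+ 2 + c ^+ 2) * z.1 ^+ 2 + (b ^+ 2 + e ^+ 2) * z.2 ^+ 2
    + (a * b + c * e) * (z.1 * z.2 *+ 2).
  rewrite /lin2/=.
  ring.
rewrite ac1 be1 abce.
by rewrite !mul1r mul0r addr0.
Qed.

(** A change of variables with determinant 1 or -1 and an invariant density. Reflections and the
    swap of coordinates are included and serve below. *)
Lemma gauss2_rot a b c e (A : set (R * R)) :
  a ^+ 2 + c ^+ 2 = 1 -> b ^+ 2 + e ^+ 2 = 1 -> a * b + c * e = 0 ->
  measurable A -> gauss2 A = gauss2 (lin2 a b c e @^-1` A).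
Proof.
move=> ac1 be1 abce mA.
have D1 : `|a * e - b * c| = 1.
  apply/eqP; rewrite -(@eqrXn2 _ 2)// ?normr_ge0// expr1n real_normK ?num_real//.
  (* The squared determinant is the Gram determinant of the columns. *)
  have -> : (a * e - b * c) ^+ 2 =
      (a ^+ 2 + c ^+ 2) * (b ^+ 2 + e ^+ 2) - (a * b + c * e) ^+ 2 by ring.
  by rewrite ac1 be1 abce mulr1 expr0n subr0.
have mA' : measurable (lin2 a b c e @^-1` A).
  by rewrite -[X in measurable X]setTI; exact: measurable_lin2.
rewrite !gauss2E// integral_mkcond [RHS]integral_mkcond.
rewrite (@ge0_integral_lin2 _ a b c e).
- rewrite D1 mul1e; apply: eq_integral => z _.
  rewrite !patchE.
  have -> : (z \in lin2 a b c e @^-1` A) = (lin2 a b c e z \in A).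
    by apply/idP/idP; rewrite !inE.
  by case: ifPn => //; rewrite gauss2_density_rot.
- by rewrite -normr_eq0 D1 oner_eq0.
- apply/(measurable_restrictT _ _).1 => //; apply: measurable_funTS.
  by apply/measurable_EFinP; exact: measurable_gauss2_density.
- by move=> z; rewrite patchE; case: ifPn => // _; rewrite lee_fin gauss2_density_ge0.
Qed.

End gauss2.

(** The Radon-Nikodym derivative of [nu] and [f] have the same integral over every measurable set,
    hence agree almost everywhere; the change of variables known for the former passes to [f]. *)
Lemma ge0_integral_density {d} {T : measurableType d} {R : realType}
    (mu : {sigma_finite_measure set T -> \bar R})
    (nu : {finite_measure set T -> \bar R}) (f g : T -> \bar R) :
  mu.-integrable setT f -> (forall x, 0 <= f x)%E ->
  (forall A, measurable A -> nu A = \int[mu]_(x in A) f x)%E ->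
  measurable_fun setT g -> (forall x, 0 <= g x)%E ->
  (\int[nu]_x g x = \int[mu]_x (g x * f x))%E.
Proof.
move=> fint f0 nuE mg g0.
have mf := measurable_int _ fint.
have numu : nu `<< mu.
  apply/null_content_dominatesP => A mA muA0.
  by rewrite nuE// null_set_integral//; exact: measurable_funTS.
have mRN := measurable_int _ (Radon_Nikodym_SigmaFinite.f_integrable numu).
rewrite -(Radon_Nikodym_SigmaFinite.change_of_variables numu g0 measurableT mg).
apply: ae_eq_integral => //; try exact: emeasurable_funM.
apply: ae_eqe_mul2l; apply: ae_eq_sym; apply: integral_ae_eq => // E _ mE.
by rewrite -nuE// -Radon_Nikodym_SigmaFinite.f_integral.
Qed.

Section gauss_moments.
Context {R : realType}.
Notation mu := (@lebesgue_measure R).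
Local Notation N01 := (@normal_prob R 0 1).

Lemma normal_prob_sqr_lty : (\int[N01]_x (x ^+ 2)%:E < +oo)%E.
Proof.
rewrite (@ge0_integral_density _ _ _ mu N01 (fun x => (normal_pdf 0 1 x)%:E))//; last 4 first.
- exact: integrable_normal_pdf.
- by move=> x; rewrite lee_fin normal_pdf_ge0.
- by apply/measurable_EFinP; exact: measurable_funX.
- by move=> x; rewrite lee_fin sqr_ge0.
(* [u <= exp u] at [u = x^2 / 4] bounds x^2 times the N(0, 1) density by a multiple
   of the N(0, 2) density. *)
pose s : R := Num.sqrt 2.
have s0 : s != 0 by rewrite sqrtr_eq0 -ltNge ltr0n.
pose C : R := 4 * normal_peak 1 / normal_peak s.
have C0 : 0 <= C by rewrite divr_ge0 ?mulr_ge0 ?normal_peak_ge0.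
apply: (@le_lt_trans _ _ (\int[mu]_x (C%:E * (normal_pdf 0 s x)%:E))%E).
  apply: ge0_le_integral => //.
  - by move=> x _; rewrite -EFinM lee_fin mulr_ge0 ?sqr_ge0 ?normal_pdf_ge0.
  - apply/measurable_EFinP; apply: measurable_funM; last exact: measurable_normal_pdf.
    exact: measurable_funX.
  - by apply/measurable_EFinP; apply: measurable_funM => //; exact: measurable_normal_pdf.
  move=> x _; rewrite -!EFinM lee_fin /normal_pdf (negbTE s0) oner_eq0 /C.
  rewrite (mulrA _ (normal_peak s)) divfK ?gt_eqF ?normal_peak_gt0//.
  have -> : normal_fun 0 1 x = expR (- (x ^+ 2 / 4)) * normal_fun 0 s x.
    rewrite /normal_fun -expRD subr0 expr1n sqr_sqrtr//; congr expR.
    by field.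
  rewrite [leLHS](_ : _ = normal_peak 1 * normal_fun 0 s x *
    (x ^+ 2 * expR (- (x ^+ 2 / 4)))); last by ring.
  rewrite [leRHS](_ : _ = normal_peak 1 * normal_fun 0 s x * 4); last by ring.
  rewrite ler_wpM2l ?mulr_ge0 ?normal_peak_ge0 ?normal_fun_ge0//.
  rewrite expRN ler_pdivrMr ?expR_gt0// -ler_pdivrMl// mulrC.
  by rewrite (le_trans _ (expR_ge1Dx _))// lerDr.
rewrite ge0_integralZl//.
- by rewrite integral_normal_pdf mule1 ltry.
- by apply/measurable_EFinP; exact: measurable_normal_pdf.
- by move=> x _; rewrite lee_fin normal_pdf_ge0.
Qed.

(** If the integral vanished, the law would be carried by [[set 0]], which is null by absolute
    continuity with respect to Lebesgue measure. *)
Lemma normal_prob_norm_gt0 : (0 < \int[N01]_x `|x|%:E)%E.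
Proof.
rewrite lt0e integral_ge0 ?andbT; last by move=> x _; rewrite lee_fin.
apply/eqP => int0.
have mid : measurable_fun setT (fun x : measurableTypeR R => x%:E) by apply/measurable_EFinP.
have neg0 : N01.-negligible (~` [set 0]).
  apply: negligibleS ((ae_eq_integral_abs N01 measurableT mid).1 int0).
  by move=> x /= x0 h; apply: x0; move: (h Logic.I) => [].
have neg1 : N01.-negligible [set 0].
  apply/negligibleP => //.
  have /null_content_dominatesP := normal_prob_dominates (0:R) 1.
  by apply => //; exact: lebesgue_measure_set1.
have : N01.-negligible setT.
  by rewrite -(setvU [set 0]); exact: negligibleU.
move/negligibleP => /(_ measurableT) NT0.
by have /eqP := probability_setT N01; rewrite NT0 eq_sym onee_eq0.
Qed.



Lemma normal_prob_fst (A : set R) : measurable A -> N01 A = gauss2 (fst @^-1` A).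
Proof.
move=> mA; rewrite /gauss2 -setXT product_measure1E//.
by rewrite -[LHS]mule1 -(probability_setT N01).
Qed.

Lemma gauss2_fst (f : R -> \bar R) : measurable_fun setT f -> (forall x, 0 <= f x)%E ->
  (\int[N01]_x f x = \int[gauss2]_z f z.1)%E.
Proof.
move=> mf f0.
apply: (@ge0_integral_law _ _ _ (measurableTypeR R) R gauss2 N01 fst f) => //.
exact: normal_prob_fst.
Qed.

Lemma gauss2_integral_rot a b c e (f : R * R -> \bar R) :
  a ^+ 2 + c ^+ 2 = 1 -> b ^+ 2 + e ^+ 2 = 1 -> a * b + c * e = 0 ->
  measurable_fun setT f ->
  (\int[gauss2]_z f z = \int[gauss2]_z f (lin2 a b c e z))%E.
Proof.
move=> ac be abce mf.
apply: (@integral_law _ _ _ _ R gauss2 gauss2 _ f (measurable_lin2 a b c e) _ mf).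
by move=> A mA; exact: gauss2_rot.
Qed.

(** E|U| for a standard normal U, that is sqrt(2 / pi); only its finiteness and positivity matter
    below. *)
Definition gabs : R := fine (\int[gauss2]_z `|z.1|%:E).

(** Gives the finiteness of [gabs], through the inclusion of L2 in L1, and the bilinearity of
    covariances. *)
Lemma Lfun2_gauss2_fst : (fst : R * R -> R) \in Lfun gauss2 2%:E.
Proof.
rewrite inE; apply/andP; split; rewrite inE/=; first exact: measurable_fst.
rewrite /finite_norm unlock/= poweR_lty//.
under eq_integral => z _ do rewrite powR_mulrn// real_normK ?num_real//.
rewrite -(@gauss2_fst (fun x => (x ^+ 2)%:E)).
- exact: normal_prob_sqr_lty.
- by apply/measurable_EFinP; exact: measurable_funX.
- by move=> x; rewrite lee_fin sqr_ge0.
Qed.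

Lemma Lfun2_gauss2_snd : (snd : R * R -> R) \in Lfun gauss2 2%:E.
Proof.
rewrite inE; apply/andP; split; rewrite inE/=; first exact: measurable_snd.
rewrite /finite_norm unlock/= poweR_lty//.
under eq_integral => z _ do rewrite powR_mulrn// real_normK ?num_real//.
(* The swap of coordinates is orthogonal and reduces to the first coordinate. *)
rewrite (@gauss2_integral_rot 0 1 1 0);
  rewrite ?expr0n ?expr1n/= ?addr0 ?add0r ?mulr0 ?mul0r ?addr0//.
  under eq_integral => z _ do rewrite /lin2 /= mul1r mul0r addr0.
  rewrite -(@gauss2_fst (fun x => (x ^+ 2)%:E)).
  - exact: normal_prob_sqr_lty.
  - by apply/measurable_EFinP; exact: measurable_funX.
  - by move=> x; rewrite lee_fin sqr_ge0.
by apply/measurable_EFinP; apply: measurable_funX; exact: measurable_snd.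
Qed.

Lemma gabsE : (\int[gauss2]_z `|z.1|%:E = gabs%:E)%E.
Proof.
rewrite /gabs fineK// ge0_fin_numE; last by apply: integral_ge0 => z _; rewrite lee_fin.
have : (fst : R * R -> R) \in Lfun gauss2 1.
  by apply: Lfun_subset12 Lfun2_gauss2_fst; exact: fin_num_measure.
by move/Lfun1_integrable => /integrableP[_].
Qed.

Lemma gabs_gt0 : 0 < gabs.
Proof.
rewrite -lte_fin -gabsE -(@gauss2_fst (fun x => `|x|%:E)).
- exact: normal_prob_norm_gt0.
- by apply/measurable_EFinP; exact: normr_measurable.
- by move=> x; rewrite lee_fin.
Qed.

(** The rotation with first row [(a / s, b / s)] turns [s * z.1] into [a * z.1 + b * z.2]. *)
Lemma gauss2_integral_norm a b :
  (\int[gauss2]_z `|a * z.1 + b * z.2|%:E = (Num.sqrt (a ^+ 2 + b ^+ 2) * gabs)%:E)%E.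
Proof.
set s := Num.sqrt _.
have s2 : s ^+ 2 = a ^+ 2 + b ^+ 2 by rewrite sqr_sqrtr// addr_ge0// sqr_ge0.
have [s0|s0] := eqVneq s 0.
  move: s2; rewrite s0 expr0n/= => /esym/eqP; rewrite paddr_eq0 ?sqr_ge0// !sqrf_eq0.
  case/andP => /eqP -> /eqP ->; rewrite mul0r.
  by under eq_integral do rewrite !mul0r addr0 normr0; rewrite integral0.
have s2' : (a / s) ^+ 2 + (b / s) ^+ 2 = 1.
  by rewrite !expr_div_n -mulrDl -s2 divff// sqrf_eq0.
rewrite EFinM -gabsE -ge0_integralZl//; first last.
- by rewrite lee_fin sqrtr_ge0.
- by apply/measurable_EFinP; apply: measurableT_comp => //; exact: measurable_fst.
rewrite [RHS](@gauss2_integral_rot (a / s) (b / s) (- (b / s)) (a / s)).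
- apply: eq_integral => z _; rewrite -EFinM.
  rewrite -[X in (X * _)%:E](ger0_norm (sqrtr_ge0 (a ^+ 2 + b ^+ 2))) -normrM.
  by congr (`|_|%:E); rewrite /lin2/= -/s; field.
- by rewrite sqrrN.
- by rewrite addrC.
- by ring.
- apply/measurable_EFinP; apply: measurable_funM => //.
  by apply: measurableT_comp => //; exact: measurable_fst.
Qed.

End gauss_moments.

(** * Integrals and covariances depend only on the law *)

Lemma ge0_integral_same_law {d1 d2 d3} {T1 : measurableType d1} {T2 : measurableType d2}
    {T : measurableType d3} {R : realType} (mu : measure T1 R) (nu : measure T2 R)
    (phi : T1 -> T) (psi : T2 -> T) (g : T -> \bar R) :
  measurable_fun setT phi -> measurable_fun setT psi ->
  (forall A, measurable A -> mu (phi @^-1` A) = nu (psi @^-1` A)) ->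
  measurable_fun setT g -> (forall y, 0 <= g y)%E ->
  (\int[mu]_x g (phi x) = \int[nu]_x g (psi x))%E.
Proof.
move=> mphi mpsi law mg g0.
pose psim := isMeasurableFun.Build _ _ _ _ _ mpsi.
pose psi' : {mfun T2 >-> T} := HB.pack psi psim.
transitivity (\int[pushforward nu psi']_y g y)%E.
  by symmetry; apply: ge0_integral_law => // A mA; rewrite law.
exact: ge0_integral_law.
Qed.

Lemma integral_same_law {d1 d2 d3} {T1 : measurableType d1} {T2 : measurableType d2}
    {T : measurableType d3} {R : realType} (mu : measure T1 R) (nu : measure T2 R)
    (phi : T1 -> T) (psi : T2 -> T) (g : T -> \bar R) :
  measurable_fun setT phi -> measurable_fun setT psi ->
  (forall A, measurable A -> mu (phi @^-1` A) = nu (psi @^-1` A)) ->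
  measurable_fun setT g ->
  (\int[mu]_x g (phi x) = \int[nu]_x g (psi x))%E.
Proof.
move=> mphi mpsi law mg.
pose psim := isMeasurableFun.Build _ _ _ _ _ mpsi.
pose psi' : {mfun T2 >-> T} := HB.pack psi psim.
transitivity (\int[pushforward nu psi']_y g y)%E.
  by symmetry; apply: integral_law => // A mA; rewrite law.
exact: integral_law.
Qed.

(** Once the centring constants [cf] and [cg] agree on both sides, the covariance is itself the
    expectation of a function of the common variable. *)
Lemma covariance_same_law {d1 d2 d3} {T1 : measurableType d1} {T2 : measurableType d2}
    {T : measurableType d3} {R : realType} (P : probability T1 R) (Q : probability T2 R)
    (phi : T1 -> T) (psi : T2 -> T) (f g : T -> R) :
  measurable_fun setT phi -> measurable_fun setT psi ->
  (forall A, measurable A -> P (phi @^-1` A) = Q (psi @^-1` A)) ->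
  measurable_fun setT f -> measurable_fun setT g ->
  covariance P (f \o phi) (g \o phi) = covariance Q (f \o psi) (g \o psi).
Proof.
move=> mphi mpsi law mf mg.
have expE (h : T -> R) : measurable_fun setT h ->
    ('E_P[h \o phi] = 'E_Q[h \o psi])%E.
  move=> mh; rewrite unlock.
  by apply: (integral_same_law (g := EFin \o h) mphi mpsi law); apply/measurable_EFinP.
rewrite unlock (expE f)// (expE g)//.
set cf := fine _; set cg := fine _.
apply: (expE (fun x => (f x - cf) * (g x - cg))).
by apply: measurable_funM; apply: measurable_funB.
Qed.

(** * Covariances of affine functions of a standard Gaussian vector *)

Section gauss_covariance.
Context {R : realType}.
Implicit Types a b c e m : R.

Lemma covariance_gauss2_rot a b c e (f g : R * R -> R) :
  a ^+ 2 + c ^+ 2 = 1 -> b ^+ 2 + e ^+ 2 = 1 -> a * b + c * e = 0 ->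
  measurable_fun setT f -> measurable_fun setT g ->
  covariance gauss2 f g = covariance gauss2 (f \o lin2 a b c e) (g \o lin2 a b c e).
Proof.
move=> ac be abce mf mg.
have law A : measurable A -> gauss2 (id @^-1` A) = gauss2 (lin2 a b c e @^-1` A).
  exact: gauss2_rot.
by have := @covariance_same_law _ _ _ _ _ _ R gauss2 gauss2 id _ f g
  (@measurable_id _ _ _) (measurable_lin2 a b c e) law mf mg.
Qed.

(** The variance of a standard normal variable. Its value 1 is never computed, as it cancels in the
    Pearson correlation. *)
Definition gvar : R := fine (covariance gauss2 (fst : R * R -> R) fst).

Let F1 : (fst : R * R -> R) \in Lfun gauss2 2%:E := Lfun2_gauss2_fst.
Let F2 : (snd : R * R -> R) \in Lfun gauss2 2%:E := Lfun2_gauss2_snd.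

Let Pfin : gauss2 (setT : set (R * R)) \is a fin_num.
Proof. exact: fin_num_measure. Qed.

Let to1 (f : R * R -> R) : f \in Lfun gauss2 2%:E -> f \in Lfun gauss2 1.
Proof. exact: Lfun_subset12. Qed.

Let cov_fin (f g : R * R -> R) : f \in Lfun gauss2 2%:E -> g \in Lfun gauss2 2%:E ->
  covariance gauss2 f g \is a fin_num.
Proof.
by move=> f2 g2; exact: covariance_fin_num (to1 f2) (to1 g2) (Lfun2_mul_Lfun1 f2 g2).
Qed.

Lemma gvarE : covariance gauss2 (fst : R * R -> R) fst = gvar%:E.
Proof. by rewrite /gvar fineK// cov_fin. Qed.

Lemma covariance_gauss2_snd : covariance gauss2 (snd : R * R -> R) snd = gvar%:E.
Proof.
rewrite (@covariance_gauss2_rot 0 1 1 0)//; last 3 first.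
- by rewrite expr0n expr1n add0r.
- by rewrite expr0n expr1n addr0.
- by rewrite mulr0 mul0r addr0.
rewrite -gvarE; congr (covariance _ _ _);
by apply/funext => z; rewrite /lin2/= mul0r mul1r addr0.
Qed.

Lemma covariance_gauss2_fst_snd : covariance gauss2 (fst : R * R -> R) snd = 0%E.
Proof.
(* The reflection (x, y) |-> (x, - y) preserves [gauss2] and negates this covariance. *)
set C := covariance _ _ _.
have Cfin : C \is a fin_num by exact: cov_fin.
have : C = (- C)%E.
  rewrite {1}/C (@covariance_gauss2_rot 1 0 0 (-1))//; last 3 first.
  - by rewrite expr0n expr1n addr0.
  - by rewrite expr0n sqrrN expr1n add0r.
  - by rewrite mulr0 mul0r addr0.
  rewrite [X in covariance _ X _](_ : _ = fst); last first.
    by apply/funext => z; rewrite /lin2/= mul0r mul1r addr0.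
  rewrite [X in covariance _ _ X](_ : _ = (\- snd)%R); last first.
    by apply/funext => z; rewrite /lin2/= mul0r mulN1r add0r.
  exact: covarianceNr (to1 F1) (to1 F2) (Lfun2_mul_Lfun1 F1 F2).
move: Cfin; case: C => // r _ [] /eqP.
by rewrite -addr_eq0 -mulr2n mulrn_eq0/= => /eqP ->.
Qed.

(** Bilinearity, the two coordinates being uncorrelated with common variance [gvar]. *)
Lemma covariance_gauss2_affine m1 a b m2 c e :
  covariance gauss2 (fun z : R * R => m1 + a * z.1 + b * z.2)
                    (fun z : R * R => m2 + c * z.1 + e * z.2) =
  ((a * c + b * e) * gvar)%:E.
Proof.
have le12 : (1 <= 2 :> R) by rewrite ler1n.
have affE m x y : (fun z : R * R => m + x * z.1 + y * z.2) =
    (cst m \+ (x \o* fst \+ y \o* snd))%R.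
  by apply/funext => z /=; rewrite addrA (mulrC x) (mulrC y).
have Fc m : cst m \in Lfun (@gauss2 R) 2%:E by exact: Lfun_cst.
have Fx x : (x \o* fst : R * R -> R)%R \in Lfun gauss2 2%:E by exact: Lfun_scale.
have Fy y : (y \o* snd : R * R -> R)%R \in Lfun gauss2 2%:E by exact: Lfun_scale.
have FD (f g : R * R -> R) : f \in Lfun gauss2 2%:E -> g \in Lfun gauss2 2%:E ->
    (f \+ g)%R \in Lfun gauss2 2%:E.
  have le12E : (1 <= 2%:E :> \bar R)%E by rewrite lee_fin.
  by case: (Lfun_addr_closed gauss2 le12E) => _; exact.
have CZ x y (f g : R * R -> R) : f \in Lfun gauss2 2%:E -> g \in Lfun gauss2 2%:E ->
    covariance gauss2 (x \o* f)%R (y \o* g)%R = (x%:E * (y%:E * covariance gauss2 f g))%E.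
  move=> f2 g2; have yg2 : (y \o* g)%R \in Lfun gauss2 2%:E by exact: Lfun_scale.
  rewrite (covarianceZl x (to1 f2) (to1 yg2) (Lfun2_mul_Lfun1 f2 yg2)).
  by rewrite (covarianceZr y (to1 f2) (to1 g2) (Lfun2_mul_Lfun1 f2 g2)).
have Fxy x y := FD _ _ (Fx x) (Fy y).
rewrite !affE covarianceDl ?FD// covariance_cst_l add0e.
rewrite covarianceDr ?FD// covariance_cst_r add0e.
rewrite covarianceDl ?FD// !covarianceDr// !CZ//.
rewrite gvarE covariance_gauss2_snd (covarianceC _ snd) covariance_gauss2_fst_snd.
by rewrite !mule0 adde0 add0e -!EFinM -EFinD; congr EFin; ring.
Qed.
End gauss_covariance.

(** * Bounds on the earth mover's distance *)
Section emd_bounds.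
Context {R : realType}.
Implicit Types mu nu : set (R * R) -> \bar R.

Lemma measurable_manhattan : measurable_fun setT (@manhattan R).
Proof.
by apply: measurable_funD; apply: (measurableT_comp (@normr_measurable R _)) => //;
  apply: measurable_funB; apply: measurableT_comp.
Qed.

Lemma manhattan_ge0 (z : (R * R) * (R * R)) : 0 <= manhattan z.
Proof. by rewrite addr_ge0. Qed.

Lemma emd_ge0 mu nu : (0 <= emd mu nu)%E.
Proof.
apply: le_ereal_inf_tmp => _ [gamma _ <-].
by apply: integral_ge0 => z _; rewrite lee_fin manhattan_ge0.
Qed.

(** Two maps on one probability space with the prescribed image laws form a coupling: the law of
    [(F, G)]. *)
Lemma emd_le_coupling {d} {T : measurableType d} (Q : probability T R)
    mu nu (F G : T -> R * R) :
  measurable_fun setT F -> measurable_fun setT G ->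
  (forall A, measurable A -> mu A = Q (F @^-1` A)) ->
  (forall A, measurable A -> nu A = Q (G @^-1` A)) ->
  (emd mu nu <= \int[Q]_t (manhattan (F t, G t))%:E)%E.
Proof.
move=> mF mG muE nuE.
have mFG : measurable_fun setT (fun t => (F t, G t)) by exact/measurable_fun_pairP.
pose FGm := isMeasurableFun.Build _ _ _ _ _ mFG.
pose FG : {mfun T >-> ((R * R) * (R * R))%type} := HB.pack (fun t => (F t, G t)) FGm.
apply: ereal_inf_lbound; exists (distribution Q FG).
  by move=> A mA; rewrite muE// nuE.
rewrite ge0_integral_distribution//.
- by apply/measurable_EFinP; exact: measurable_manhattan.
- by move=> z; rewrite lee_fin manhattan_ge0.
Qed.

Lemma emd_diagonal_ge {d1 d2} {T1 : measurableType d1} {T2 : measurableType d2}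
    (P : probability T1 R) (Q : probability T2 R) mu nu (f : T1 -> R) (G : T2 -> R * R) :
  measurable_fun setT f -> measurable_fun setT G ->
  (forall A, measurable A -> mu A = P ((fun t => (f t, f t)) @^-1` A)) ->
  (forall A, measurable A -> nu A = Q (G @^-1` A)) ->
  (\int[Q]_t `|(G t).1 - (G t).2|%:E <= emd mu nu)%E.
Proof.
move=> mf mG muE nuE; apply: le_ereal_inf_tmp => _ [gamma cpl <-].
(* |z.2.1 - z.2.2| <= manhattan z + |z.1.1 - z.1.2|, where the last term has integral 0. *)
have mff : measurable_fun setT (fun t => (f t, f t)) by exact/measurable_fun_pairP.
pose h : R * R -> \bar R := fun p => `|p.1 - p.2|%:E.
have mh : measurable_fun setT h.
  by apply/measurable_EFinP; apply: (measurableT_comp (@normr_measurable R _)) => //;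
    exact: measurable_funB.
have h0 p : (0 <= h p)%E by rewrite lee_fin.
(* The first marginal of any coupling is [mu], which is carried by the diagonal, where [h]
   vanishes. *)
have fst0 : (\int[gamma]_z h z.1 = 0)%E.
  rewrite (@ge0_integral_same_law _ _ _ _ _ _ R gamma P fst _ h measurable_fst mff)//.
    by apply: integral0_eq => t _; rewrite /h subrr normr0.
  by move=> A mA; exact: etrans (cpl A mA).1 (muE A mA).
have -> : (\int[Q]_t `|(G t).1 - (G t).2|%:E = \int[gamma]_z h z.2)%E.
  symmetry; apply: (@ge0_integral_same_law _ _ _ _ _ _ R gamma Q snd G h measurable_snd mG) => //.
  by move=> A mA; exact: etrans (cpl A mA).2 (nuE A mA).
rewrite -[leRHS]adde0 -fst0 -ge0_integralD//.
- apply: ge0_le_integral => //.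
  + exact: measurableT_comp.
  + apply: emeasurable_funD; last exact: measurableT_comp.
    by apply/measurable_EFinP; exact: measurable_manhattan.
  + move=> [[x y] [u v]] _; rewrite /h /manhattan -EFinD lee_fin/=.
    rewrite [u - v](_ : _ = (x - y) + - (x - u) + (y - v)); last by ring.
    apply: (le_trans (ler_normD _ _)); rewrite [leRHS]addrAC lerD2r.
    by apply: (le_trans (ler_normD _ _)); rewrite normrN addrC.
- by move=> z _; rewrite lee_fin manhattan_ge0.
- by apply/measurable_EFinP; exact: measurable_manhattan.
- exact: measurableT_comp.
Qed.
End emd_bounds.

(** * Laws of affine images of a standard Gaussian vector *)

Section gauss2_laws.
Context {R : realType}.
Local Notation N01 := (@normal_prob R 0 1).
Implicit Types a b c e m s : R.

Lemma measurable_affine2 m a b :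
  measurable_fun setT (fun z : R * R => m + a * z.1 + b * z.2).
Proof.
apply: measurable_funD; last exact: measurable_funM.
by apply: measurable_funD => //; exact: measurable_funM.
Qed.

(** The law on the line is lifted to the plane through [fst], then the rotation with first row
    [(a / s, b / s)] carries [s * z.1] to [a * z.1 + b * z.2]. *)
Lemma gauss2_affine m a b (A : set R) : 0 < a ^+ 2 + b ^+ 2 -> measurable A ->
  gauss2 ((fun z => m + a * z.1 + b * z.2) @^-1` A) =
  N01 ((fun x => m + Num.sqrt (a ^+ 2 + b ^+ 2) * x) @^-1` A).
Proof.
set s := Num.sqrt _ => s2_gt0 mA.
have s0 : s != 0 by rewrite sqrtr_eq0 -ltNge.
have s2 : s ^+ 2 = a ^+ 2 + b ^+ 2 by rewrite sqr_sqrtr// ltW.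
have s2' : (a / s) ^+ 2 + (b / s) ^+ 2 = 1.
  by rewrite !expr_div_n -mulrDl -s2 divff// sqrf_eq0.
have mg : measurable_fun setT (fun x => m + s * x).
  by apply: measurable_funD => //; exact: measurable_funM.
have mA' : measurable ((fun x => m + s * x) @^-1` A).
  by rewrite -[X in measurable X]setTI; exact: mg.
rewrite (normal_prob_fst mA').
have mB : measurable (fst @^-1` ((fun x : R => m + s * x) @^-1` A) : set (R * R)).
  by rewrite -[X in measurable X]setTI; exact: measurable_fst.
have col2 : (b / s) ^+ 2 + (a / s) ^+ 2 = 1 by rewrite addrC.
have col1 : (a / s) ^+ 2 + (- (b / s)) ^+ 2 = 1 by rewrite sqrrN.
have orth : a / s * (b / s) + - (b / s) * (a / s) = 0 by ring.
rewrite [RHS](gauss2_rot col1 col2 orth mB).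
congr gauss2; apply/funext => z; rewrite /preimage/= -addrA; congr (A (_ + _)).
by field.
Qed.

(** Functions of distinct coordinates are independent; by uniqueness of the product measure, this is
    checked on rectangles. *)
Lemma gauss2_prod (p q : probability R R) (f g : R -> R) (A : set (R * R)) :
  measurable_fun setT f -> measurable_fun setT g ->
  (forall B, measurable B -> p B = N01 (f @^-1` B)) ->
  (forall B, measurable B -> q B = N01 (g @^-1` B)) ->
  measurable A ->
  (p \x q)%E A = gauss2 ((fun z => (f z.1, g z.2)) @^-1` A).
Proof.
move=> mf mg pE qE mA.
have mfg : measurable_fun setT (fun z : R * R => (f z.1, g z.2)).
  apply/measurable_fun_pairP; split.
    exact: (measurableT_comp mf measurable_fst).
  exact: (measurableT_comp mg measurable_snd).
pose fgm := isMeasurableFun.Build _ _ _ _ _ mfg.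
pose fg : {mfun (R * R)%type >-> (R * R)%type} := HB.pack (fun z : R * R => (f z.1, g z.2)) fgm.
apply: (@product_measure_unique _ _ _ _ _ p q (pushforward gauss2 fg)) => // {A mA} A B mA mB.
have mfA : measurable (f @^-1` A) by rewrite -[X in measurable X]setTI; exact: mf.
have mgB : measurable (g @^-1` B) by rewrite -[X in measurable X]setTI; exact: mg.
transitivity (N01 (f @^-1` A) * N01 (g @^-1` B))%E.
  exact: (@product_measure1E _ _ _ _ _ N01 N01 _ _ mfA mgB).
by congr (_ * _)%E; [exact: (esym (pE A mA))|exact: (esym (qE B mB))].
Qed.

End gauss2_laws.

(** * Elementary inequalities and plane geometry *)

Section real_inequalities.
Context {R : realType}.
Implicit Types r : R.

(** With [t = 1 - r ^+ 2] in [0, 1], comparing squares reduces the claim to t <= sqrt t. *)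
Lemma sqrt_one_sub_le_norm r : r ^+ 2 <= 1 ->
  Num.sqrt (1 - Num.sqrt (1 - r ^+ 2)) <= `|r|.
Proof.
move=> r1; set t := 1 - r ^+ 2.
have t0 : 0 <= t by rewrite subr_ge0.
rewrite -sqrtr_sqr ler_wsqrtr//.
have -> : r ^+ 2 = 1 - t by rewrite /t opprB addrC subrK.
rewrite lerD2l lerN2 -{1}(sqr_sqrtr t0) expr2 ler_piMr ?sqrtr_ge0//.
by rewrite -[leRHS]sqrtr1 ler_wsqrtr// /t lerBlDr lerDl sqr_ge0.
Qed.

(** Excluding -1 and 1 gives [0 < t], excluding 0 gives [t < 1], and then t < sqrt t. *)
Lemma sqrt_one_sub_lt_norm r : r ^+ 2 <= 1 -> r \notin [:: -1; 0; 1] ->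
  Num.sqrt (1 - Num.sqrt (1 - r ^+ 2)) < `|r|.
Proof.
rewrite !inE !negb_or => r1 /and3P[rN1 r0 r1'].
have r2_gt0 : 0 < r ^+ 2 by rewrite exprn_even_gt0.
have r2_lt1 : r ^+ 2 < 1.
  by rewrite lt_neqAle r1 andbT sqrf_eq1 negb_or r1' rN1.
set t := 1 - r ^+ 2.
have t0 : 0 < t by rewrite subr_gt0.
rewrite -sqrtr_sqr ltr_sqrt//.
have -> : r ^+ 2 = 1 - t by rewrite /t opprB addrC subrK.
rewrite ltrD2l ltrN2 -{1}(sqr_sqrtr (ltW t0)) expr2 gtr_pMr ?sqrtr_gt0//.
by rewrite -[ltRHS]sqrtr1 ltr_sqrt// /t ltrBlDr ltrDl.
Qed.

(** Used with [p] the inner product, [q] the determinant and [s] the product of the norms of two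
    plane vectors: it recovers |sin| from cos. *)
Lemma sqrt_one_sub_sqr_quot (p q s : R) : 0 < s -> p ^+ 2 + q ^+ 2 = s ^+ 2 ->
  Num.sqrt (1 - (p / s) ^+ 2) = `|q| / s.
Proof.
move=> s0 pq; have -> : 1 - (p / s) ^+ 2 = (q / s) ^+ 2.
  rewrite !expr_div_n -[X in X - _](@divff _ (s ^+ 2)) ?gt_eqF ?exprn_gt0//.
  by rewrite -mulrBl -pq addrAC subrr add0r.
by rewrite sqrtr_sqr normrM normfV (gtr0_norm s0).
Qed.
(* The sign [eps] selects, among the two unit vectors orthogonal to [(a, b)],
   the one closest in direction to [(c, e)]. *)
Lemma dist_orthogonal (a b c e s1 s2 : R) : 0 < s1 -> 0 < s2 ->
  s1 ^+ 2 = a ^+ 2 + b ^+ 2 -> s2 ^+ 2 = c ^+ 2 + e ^+ 2 ->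
  exists2 eps : R, eps ^+ 2 = 1 &
    Num.sqrt ((c - s2 * - (eps * b / s1)) ^+ 2 + (e - s2 * (eps * a / s1)) ^+ 2) =
    Num.sqrt 2 * s2 * Num.sqrt (1 - `|a * e - b * c| / (s1 * s2)).
Proof.
move=> s1_gt0 s2_gt0 s1E s2E.
have s1_neq0 : s1 != 0 by rewrite gt_eqF.
have s2_neq0 : s2 != 0 by rewrite gt_eqF.
pose D := a * e - b * c.
pose eps : R := if 0 <= D then 1 else -1.
have eps2 : eps ^+ 2 = 1 by rewrite /eps; case: ifP; rewrite ?sqrrN expr1n.
have epsD : eps * D = `|D| by rewrite /eps; case: ger0P; rewrite ?mul1r ?mulN1r.
exists eps => //.
rewrite [X in Num.sqrt X = _](_ : _ = 2 * s2 ^+ 2 * (1 - `|D| / (s1 * s2))).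
  rewrite (sqrtrM _ (mulr_ge0 (ler0n R 2) (sqr_ge0 s2))) (sqrtrM _ (ler0n R 2)).
  by rewrite sqrtr_sqr gtr0_norm.
rewrite -epsD.
(* Expansion of the squared distance from [(c, e)] to [s2] times the unit normal; the inner product
   of [(c, e)] with that normal is [eps * D / s1]. *)
transitivity (c ^+ 2 + e ^+ 2
  + s2 ^+ 2 * (eps ^+ 2 * (a ^+ 2 + b ^+ 2) / s1 ^+ 2) - 2 * s2 * eps * D / s1).
  by rewrite /D; field.
rewrite eps2 -s1E -s2E mul1r divff ?sqrf_eq0//; field.
by rewrite s1_neq0 s2_neq0.
Qed.
End real_inequalities.

(** * Bivariate normal vectors *)
Section normal_vector.
Context {R : realType} d (T : measurableType d) (P : probability T R).
Variables (X Y : {RV P >-> R}) (m1 m2 a b c e : R).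
Local Notation F := (fun z : R * R => (m1 + a * z.1 + b * z.2, m2 + c * z.1 + e * z.2)).
Hypothesis law : forall A : set (R * R), measurable A ->
  joint_law P X Y A = gauss2 (F @^-1` A).
Hypotheses (ab : 0 < a ^+ 2 + b ^+ 2) (ce : 0 < c ^+ 2 + e ^+ 2).

Let s1 := Num.sqrt (a ^+ 2 + b ^+ 2).
Let s2 := Num.sqrt (c ^+ 2 + e ^+ 2).
(** The cosine of the angle between [(a, b)] and [(c, e)], which is the correlation of [X] and
    [Y]. *)
Let r := (a * c + b * e) / (s1 * s2).

Let s1_gt0 : 0 < s1. Proof. by rewrite sqrtr_gt0. Qed.
Let s2_gt0 : 0 < s2. Proof. by rewrite sqrtr_gt0. Qed.
Let s1E : s1 ^+ 2 = a ^+ 2 + b ^+ 2. Proof. by rewrite sqr_sqrtr// ltW. Qed.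
Let s2E : s2 ^+ 2 = c ^+ 2 + e ^+ 2. Proof. by rewrite sqr_sqrtr// ltW. Qed.
Let s1_neq0 : s1 != 0. Proof. by rewrite gt_eqF. Qed.
Let s2_neq0 : s2 != 0. Proof. by rewrite gt_eqF. Qed.

Let mF : measurable_fun setT F.
Proof. by apply/measurable_fun_pairP; split; exact: measurable_affine2. Qed.

Let sqrt_r : Num.sqrt (1 - r ^+ 2) = `|a * e - b * c| / (s1 * s2).
Proof.
by apply: sqrt_one_sub_sqr_quot; [rewrite mulr_gt0|rewrite exprMn s1E s2E; ring].
Qed.

Lemma normal_corr_sqr_le1 : r ^+ 2 <= 1.
Proof.
rewrite /r expr_div_n ler_pdivrMr ?exprn_gt0 ?mulr_gt0// mul1r exprMn s1E s2E.
rewrite -subr_ge0 [leRHS](_ : _ = (a * e - b * c) ^+ 2) ?sqr_ge0//; ring.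
Qed.

Lemma normal_prod_law A : measurable A ->
  (distribution P X \x distribution P Y)%E A =
  gauss2 ((fun z => (m1 + s1 * z.1, m2 + s2 * z.2)) @^-1` A).
Proof.
have aff m s : measurable_fun setT (fun x : R => m + s * x).
  by apply: measurable_funD => //; exact: measurable_funM.
apply: (@gauss2_prod R (distribution P X) (distribution P Y)
  (fun x => m1 + s1 * x) (fun x => m2 + s2 * x)) => // B mB.
- have mB1 : measurable (fst @^-1` B : set (R * R)).
    by rewrite -[X in measurable X]setTI; exact: measurable_fst.
  exact: etrans (law mB1) (gauss2_affine m1 ab mB).
- have mB2 : measurable (snd @^-1` B : set (R * R)).
    by rewrite -[X in measurable X]setTI; exact: measurable_snd.
  exact: etrans (law mB2) (gauss2_affine m2 ce mB).
Qed.

(** An orthogonal image of the Gaussian vector driving [(X, Y)] is again standard, so rescaling its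
    coordinates by [s1] and [s2] gives the product law on the same space. Coordinatewise differences
    are linear in [z], so the cost is explicit. *)
Lemma eCov_le_rot a' b' c' e' :
  a' ^+ 2 + c' ^+ 2 = 1 -> b' ^+ 2 + e' ^+ 2 = 1 -> a' * b' + c' * e' = 0 ->
  (eCov X Y <= ((Num.sqrt ((a - s1 * a') ^+ 2 + (b - s1 * b') ^+ 2)
     + Num.sqrt ((c - s2 * c') ^+ 2 + (e - s2 * e') ^+ 2)) * gabs)%:E)%E.
Proof.
move=> col1 col2 orth.
pose G (z : R * R) := (m1 + s1 * (lin2 a' b' c' e' z).1, m2 + s2 * (lin2 a' b' c' e' z).2).
have mG' : measurable_fun setT (fun z : R * R => (m1 + s1 * z.1, m2 + s2 * z.2)).
  by apply/measurable_fun_pairP; split; apply: measurable_funD => //; apply: measurable_funM.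
have mG : measurable_fun setT G.
  exact: (measurableT_comp mG' (measurable_lin2 a' b' c' e')).
have nuE A : measurable A -> (distribution P X \x distribution P Y)%E A = gauss2 (G @^-1` A).
  move=> mA; apply: etrans (normal_prod_law mA) _.
  have mGA : measurable ((fun z : R * R => (m1 + s1 * z.1, m2 + s2 * z.2)) @^-1` A).
    by rewrite -[X in measurable X]setTI; exact: mG'.
  exact: (gauss2_rot col1 col2 orth mGA).
apply: (le_trans (emd_le_coupling mF mG law nuE)).
rewrite mulrDl EFinD -!gauss2_integral_norm -ge0_integralD//; last 2 first.
- apply/measurable_EFinP; apply: (measurableT_comp (@normr_measurable R _)) => //.
  by apply: measurable_funD; apply: measurable_funM.
- apply/measurable_EFinP; apply: (measurableT_comp (@normr_measurable R _)) => //.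
  by apply: measurable_funD; apply: measurable_funM.
rewrite le_eqVlt; apply/orP; left; apply/eqP; apply: eq_integral => z _.
rewrite /manhattan /G /lin2/= -EFinD; congr (_ + _)%:E; congr `|_|; ring.
Qed.

(** The first row [(a / s1, b / s1)] keeps [X] unchanged at no cost; the second row is the unit
    normal given by [dist_orthogonal]. *)
Lemma eCov_le_snd : (eCov X Y <=
  (Num.sqrt 2 * s2 * Num.sqrt (1 - Num.sqrt (1 - r ^+ 2)) * gabs)%:E)%E.
Proof.
have [eps eps2 dE] := dist_orthogonal s1_gt0 s2_gt0 s1E s2E.
have u1 : (a / s1) ^+ 2 + (b / s1) ^+ 2 = 1.
  by rewrite !expr_div_n -mulrDl -s1E divff// sqrf_eq0.
have := @eCov_le_rot (a / s1) (b / s1) (- (eps * b / s1)) (eps * a / s1).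
have -> : (a / s1) ^+ 2 + (- (eps * b / s1)) ^+ 2 = 1.
  by rewrite sqrrN -mulrA [(eps * _) ^+ 2]exprMn eps2 mul1r.
have -> : (b / s1) ^+ 2 + (eps * a / s1) ^+ 2 = 1.
  by rewrite -mulrA [(eps * _) ^+ 2]exprMn eps2 mul1r addrC.
have -> : a / s1 * (b / s1) + - (eps * b / s1) * (eps * a / s1) = 0.
  rewrite [LHS](_ : _ = (1 - eps ^+ 2) * (a / s1 * (b / s1))); last by ring.
  by rewrite eps2 subrr mul0r.
move=> /(_ erefl erefl erefl).
rewrite ![s1 * (_ / s1)]mulrC !divfK// !subrr !expr0n/= addr0 sqrtr0 add0r.
by rewrite dE sqrt_r.
Qed.

(** Here the second row [(c / s2, e / s2)] keeps [Y]; exchanging the roles only flips the sign of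
    the determinant. *)
Lemma eCov_le_fst : (eCov X Y <=
  (Num.sqrt 2 * s1 * Num.sqrt (1 - Num.sqrt (1 - r ^+ 2)) * gabs)%:E)%E.
Proof.
have [eps eps2 dE] := dist_orthogonal s2_gt0 s1_gt0 s2E s1E.
have u2 : (c / s2) ^+ 2 + (e / s2) ^+ 2 = 1.
  by rewrite !expr_div_n -mulrDl -s2E divff// sqrf_eq0.
have := @eCov_le_rot (- (eps * e / s2)) (eps * c / s2) (c / s2) (e / s2).
have -> : (- (eps * e / s2)) ^+ 2 + (c / s2) ^+ 2 = 1.
  by rewrite sqrrN -mulrA [(eps * _) ^+ 2]exprMn eps2 mul1r addrC.
have -> : (eps * c / s2) ^+ 2 + (e / s2) ^+ 2 = 1.
  by rewrite -mulrA [(eps * _) ^+ 2]exprMn eps2 mul1r.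
have -> : - (eps * e / s2) * (eps * c / s2) + c / s2 * (e / s2) = 0.
  rewrite [LHS](_ : _ = (1 - eps ^+ 2) * (c / s2 * (e / s2))); last by ring.
  by rewrite eps2 subrr mul0r.
move=> /(_ erefl erefl erefl).
rewrite ![s2 * (_ / s2)]mulrC !divfK// !subrr !expr0n/= addr0 sqrtr0 addr0.
rewrite dE sqrt_r (mulrC s2) (_ : c * b - e * a = - (a * e - b * c)) ?normrN//; ring.
Qed.

(** Makes the results on pairs available for [(X, X)], hence for [eVar] and the variance. *)
Lemma normal_fst_law (A : set (R * R)) : measurable A ->
  joint_law P X X A =
  gauss2 ((fun z : R * R => (m1 + a * z.1 + b * z.2, m1 + a * z.1 + b * z.2)) @^-1` A).
Proof.
move=> mA.
have mdup : measurable_fun setT (fun z : R * R => (z.1, z.1)).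
  by apply/measurable_fun_pairP; split; exact: measurable_fst.
have mA' : measurable ((fun z : R * R => (z.1, z.1)) @^-1` A).
  by rewrite -[X in measurable X]setTI; exact: mdup.
exact: (law mA').
Qed.

Lemma normal_snd_law (A : set (R * R)) : measurable A ->
  joint_law P Y Y A =
  gauss2 ((fun z : R * R => (m2 + c * z.1 + e * z.2, m2 + c * z.1 + e * z.2)) @^-1` A).
Proof.
move=> mA.
have mdup : measurable_fun setT (fun z : R * R => (z.2, z.2)).
  by apply/measurable_fun_pairP; split; exact: measurable_snd.
have mA' : measurable ((fun z : R * R => (z.2, z.2)) @^-1` A).
  by rewrite -[X in measurable X]setTI; exact: mdup.
exact: (law mA').
Qed.

Lemma normal_covariance : covariance P X Y = ((a * c + b * e) * gvar)%:E.
Proof.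
have mXY : measurable_fun setT (fun t => (X t, Y t)) by exact/measurable_fun_pairP.
have := @covariance_same_law _ _ _ _ _ _ R P gauss2 _ F fst snd mXY mF law
  measurable_fst measurable_snd.
rewrite -(covariance_gauss2_affine m1 a b m2 c e); exact.
Qed.

End normal_vector.

(** * Earth mover's variance of a normal variable *)

Section normal_variance.
Context {R : realType} d (T : measurableType d) (P : probability T R).
Variables (X : {RV P >-> R}) (m a b : R).
Hypothesis law : forall A : set (R * R), measurable A ->
  joint_law P X X A =
  gauss2 ((fun z : R * R => (m + a * z.1 + b * z.2, m + a * z.1 + b * z.2)) @^-1` A).
Hypothesis ab : 0 < a ^+ 2 + b ^+ 2.

(** The upper bound is [eCov_le_fst] for [(X, X)], where the correlation is 1; the lower bound is
    [emd_diagonal_ge]. The upper bound also yields finiteness. *)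
Lemma normal_eVar :
  (eVar X = (Num.sqrt 2 * Num.sqrt (a ^+ 2 + b ^+ 2) * gabs)%:E)%E.
Proof.
set s := Num.sqrt (a ^+ 2 + b ^+ 2).
apply/eqP; rewrite eq_le; apply/andP; split.
  have := eCov_le_fst law ab ab; rewrite -/s.
  have -> : (a * a + b * b) / (s * s) = 1.
    by rewrite -!expr2 sqr_sqrtr ?ltW// divff// gt_eqF.
  by rewrite expr1n subrr sqrtr0 subr0 sqrtr1 mulr1.
have mG : measurable_fun setT (fun z : R * R => (m + s * z.1, m + s * z.2)).
  by apply/measurable_fun_pairP; split; apply: measurable_funD => //; apply: measurable_funM.
have mX : measurable_fun setT X by [].
apply: le_trans (emd_diagonal_ge mX mG (fun A mA => erefl) (normal_prod_law law ab ab)).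
(* The difference of two independent copies has coefficients [s] and [- s]. *)
rewrite (_ : Num.sqrt 2 * s = Num.sqrt (s ^+ 2 + (- s) ^+ 2)); last first.
  rewrite (_ : s ^+ 2 + (- s) ^+ 2 = 2 * s ^+ 2); last by ring.
  by rewrite (sqrtrM _ (ler0n R 2)) sqrtr_sqr ger0_norm ?sqrtr_ge0.
rewrite -gauss2_integral_norm le_eqVlt; apply/orP; left; apply/eqP.
by apply: eq_integral => z _ /=; congr (`|_|%:E); ring.
Qed.
End normal_variance.

Unset Implicit Arguments.
Theorem theorem4 (R : realType) (d : measure_display) (T : measurableType d)
  (P : probability T R) (X Y : {RV P >-> R}) :
  bivariate_normal P X Y ->
  (0 < variance P X)%E -> (0 < variance P Y)%E ->
  let rho := pearson P X Y in
  (eCov X Y \is a fin_num /\ eVar X \is a fin_num /\ eVar Y \is a fin_num /\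
   (0 < Order.min (eVar X) (eVar Y))%E) /\
  eCor X Y <= Num.sqrt (1 - Num.sqrt (1 - rho ^+ 2)) /\
  Num.sqrt (1 - Num.sqrt (1 - rho ^+ 2)) <= `|rho| /\
  (rho \notin [:: -1; 0; 1] ->
   Num.sqrt (1 - Num.sqrt (1 - rho ^+ 2)) < `|rho|).
Proof.
move=> [m1 [m2 [a [b [c [e law']]]]]] vX vY rho.
have law (A : set (R * R)) : measurable A -> joint_law P X Y A =
    gauss2 ((fun z : R * R => (m1 + a * z.1 + b * z.2, m2 + c * z.1 + e * z.2)) @^-1` A).
  exact: law'.
have lawX := normal_fst_law law.
have lawY := normal_snd_law law.
have varX : variance P X = ((a ^+ 2 + b ^+ 2) * gvar)%:E.
  by rewrite /variance (normal_covariance lawX) -!expr2.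
have varY : variance P Y = ((c ^+ 2 + e ^+ 2) * gvar)%:E.
  by rewrite /variance (normal_covariance lawY) -!expr2.
move: vX vY; rewrite varX varY !lte_fin => vX vY.
have ab0 : 0 <= a ^+ 2 + b ^+ 2 by rewrite addr_ge0 ?sqr_ge0.
have ce0 : 0 <= c ^+ 2 + e ^+ 2 by rewrite addr_ge0 ?sqr_ge0.
(* Positivity of [gvar] is read off from that of the variance of [X]. *)
have gvar_gt0 : 0 < gvar :> R.
  by move: vX; rewrite ltNge; apply: contraNlt => v0; rewrite mulr_ge0_le0.
have ab : 0 < a ^+ 2 + b ^+ 2 by move: vX; rewrite pmulr_lgt0.
have ce : 0 < c ^+ 2 + e ^+ 2 by move: vY; rewrite pmulr_lgt0.
set s1 := Num.sqrt (a ^+ 2 + b ^+ 2).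
set s2 := Num.sqrt (c ^+ 2 + e ^+ 2).
have s1_gt0 : 0 < s1 by rewrite sqrtr_gt0.
have s2_gt0 : 0 < s2 by rewrite sqrtr_gt0.
have rhoE : rho = (a * c + b * e) / (s1 * s2).
  rewrite /rho /pearson varX varY (normal_covariance law)/=.
  rewrite mulrACA -expr2 sqrtrM ?mulr_ge0// sqrtr_sqr (gtr0_norm gvar_gt0).
  rewrite (sqrtrM _ ab0) -/s1 -/s2 -mulf_div divff ?mulr1// gt_eqF//.
have rho1 : rho ^+ 2 <= 1 by rewrite rhoE; exact: normal_corr_sqr_le1.
set w := Num.sqrt (1 - _).
have eX : eVar X = (Num.sqrt 2 * s1 * gabs)%:E := normal_eVar lawX ab.
have eY : eVar Y = (Num.sqrt 2 * s2 * gabs)%:E := normal_eVar lawY ce.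
have le1 : (eCov X Y <= (Num.sqrt 2 * s1 * w * gabs)%:E)%E.
  by rewrite /w rhoE; exact: (eCov_le_fst law ab ce).
have le2 : (eCov X Y <= (Num.sqrt 2 * s2 * w * gabs)%:E)%E.
  by rewrite /w rhoE; exact: (eCov_le_snd law ab ce).
have g0 := @gabs_gt0 R.
have q0 : 0 < Num.sqrt 2 :> R by rewrite sqrtr_gt0.
have covfin : eCov X Y \is a fin_num.
  by rewrite ge0_fin_numE ?emd_ge0// (le_lt_trans le1)// ltry.
split; [split => //; split; [by rewrite eX|split; [by rewrite eY|]]|split; [|split]].
- by rewrite lt_min eX eY !lte_fin !mulr_gt0.
- rewrite /eCor eX eY -(fineK covfin) /=.
  move: le1 le2; rewrite -(fineK covfin) !lee_fin => le1 le2.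
  rewrite -EFin_min /= ler_pdivrMr ?lt_min ?mulr_gt0//.
  (* Whichever variance realizes the minimum, the bound on [eCov X Y] with the same standard
     deviation applies. *)
  rewrite /Order.min; case: ifP => _.
  + by rewrite (le_trans le1)// le_eqVlt; apply/orP; left; apply/eqP; ring.
  + by rewrite (le_trans le2)// le_eqVlt; apply/orP; left; apply/eqP; ring.
- exact: sqrt_one_sub_le_norm.
- exact: sqrt_one_sub_lt_norm.
Qed.
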